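(* For a given $k\in\mathbb{N}$, let $L_0\subseteq L_1\subseteq\dots\subseteq L_k\subseteq H$ be a sequence of linear subspaces of $\mathbb{R}^n$, where $\dim L_t=t$ for $t=0,\dots,k$, and $H$ is a rational subspace. Then for every $\delta>0$ there exists $M>0$ such that the following holds: for every $x\in L_k$ and for every $y_1,\dots,y_k$ satisfying $y_t\in x+L_t$ and $\operatorname{dist}(y_t,x+L_{t-1})\ge M$ for $t=1,\dots,k$, one has $$\operatorname{dist}\bigl(\operatorname{conv}(x,y_1,\dots,y_k),\,H\cap\mathbb{Z}^n\bigr)\le\delta.$$
   Context: $\operatorname{dist}(A,B)=\inf\{\|a-b\|:a\in A,\ b\in B\}$ is the Euclidean distance between subsets of $\mathbb{R}^n$ (for a point $a$, $\operatorname{dist}(a,B)=\operatorname{dist}(\{a\},B)$), and $\operatorname{conv}(x,y_1,\dots,y_k)$ is the convex hull of the listed points. A linear subspace is rational if it is spanned by rational vectors; the $L_t$ are not assumed rational. Here $\mathbb{N}$ includes $0$. *)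

(* Defs.v *)
From mathcomp Require Import all_boot all_order all_algebra.
From mathcomp Require Import all_classical all_reals all_analysis.

Set Implicit Arguments.
Unset Strict Implicit.
Unset Printing Implicit Defensive.

Import Order.TTheory GRing.Theory Num.Theory.

Local Open Scope classical_set_scope.
Local Open Scope ring_scope.

(* The norm `|v| provided by the library on matrices is the sup norm. *)
Definition enorm (R : realType) (n : nat) (v : 'rV[R]_n) : R :=
  Num.sqrt (\sum_(j < n) v 0 j ^+ 2).

(* [inf] is real-valued, with [inf set0 = 0]: this is the usual distance only
   when A and B are both nonempty. *)
Definition dist (R : realType) (n : nat) (A B : set 'rV[R]_n) : R :=
  inf [set enorm (a - b) | a in A & b in B].

Definition conv_hull (R : realType) (n : nat) (A : set 'rV[R]_n) :
    set 'rV[R]_n :=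
  smallest (@convex_set R 'rV[R]_n) A.

Definition translate (R : realType) (n : nat) (x : 'rV[R]_n)
    (U : {vspace 'rV[R]_n}) : set 'rV[R]_n :=
  [set x + u | u in [set` U]].

Definition rational_subspace (R : realType) (n : nat)
    (U : {vspace 'rV[R]_n}) : Prop :=
  exists s : seq 'rV[rat]_n, U = <<[seq map_mx ratr v | v <- s]>>%VS.

Definition integer_points (R : realType) (n : nat) : set 'rV[R]_n :=
  [set z | z \is a mxOver Num.int].
Arguments integer_points : clear implicits.

(* Main.v *)
Require Import Defs.
From mathcomp Require Import all_boot all_order all_algebra.
From mathcomp Require Import all_classical all_reals all_analysis.
From mathcomp Require Import ring lra.

(** Choose v_1, ..., v_k in H with L_t = L_(t-1) + <v_t>, and write Gamma for
    the group of integer points of H.  The proof looks for the required point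
    of the simplex in the form p = x + \sum_t lam_t (y_t - x) with every lam_t
    in [0, 1/(k+1)]; such a p is in the convex hull whatever the lam_t are
    ([conv_hull_small_steps]).

    The lam_t are chosen in the order t = k, k-1, ..., 1.  Since y_t - x has
    no component on v_(t+1), ..., v_k, the coefficient of v_t in p depends on
    lam_t, ..., lam_k only; once lam_(t+1), ..., lam_k are fixed it is an affine
    function of lam_t, of slope the coefficient a_t of v_t in y_t - x.  The
    distance hypothesis says that |a_t| is large, so as lam_t runs over
    [0, 1/(k+1)] this coefficient sweeps a long interval of the line.  It then
    suffices that the set of u such that u v_t is close to Gamma meets every
    interval of a certain length: lam_t can be chosen so that the component of
    p on v_t is close to Gamma, and p, the sum of its k components, is close
    to Gamma as well ([flag_simplex_near_lattice]).

    That such return times are relatively dense ([relatively_dense_returns])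
    is a pigeonhole argument.  As H is rational, v_t is a real combination
    of integer vectors of H, and u v_t is close to Gamma as soon as u times each
    coefficient is close to an integer; that the latter happens for a relatively
    dense set of u is [relatively_dense_almost_periods].

    All estimates use the sup norm, which dominates [enorm] up to a factor
    depending on the dimension. *)

Set Implicit Arguments.
Unset Strict Implicit.
Unset Printing Implicit Defensive.

Import Order.TTheory GRing.Theory Num.Theory.

Local Open Scope classical_set_scope.
Local Open Scope ring_scope.

(** * Return times of a line to a lattice *)

(** Writing N for N.+1: if floor (N a) - floor (N b) = N p, then N (a - b - p)
    is the difference of the fractional parts of N a and N b.  Residues of
    floors are thus a finite classification of reals up to small perturbations
    and integer shifts. *)
Lemma floor_congr_near_int (R : realType) (N : nat) (a b : R) :
  (Num.floor (N.+1%:R * a) = Num.floor (N.+1%:R * b) %[mod N.+1])%Z ->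
  exists p : int, `|a - b - p%:~R| <= N.+1%:R^-1.
Proof.
move=> /eqP; rewrite eqz_mod_dvd => /dvdzP[p hp]; exists p.
have N0 : 0 < N.+1%:R :> R by [].
have /andP[a1 a2] := floor_itv (N.+1%:R * a).
have /andP[b1 b2] := floor_itv (N.+1%:R * b).
have {hp} : (Num.floor (N.+1%:R * a))%:~R - (Num.floor (N.+1%:R * b))%:~R
   = p%:~R * N.+1%:R :> R by rewrite -rmorphB /= hp rmorphM.
move: a1 a2 b1 b2; rewrite !rmorphD /= => a1 a2 b1 b2 hp.
rewrite -(ler_pM2l N0) divff ?gt_eqF//.
rewrite -{1}(gtr0_norm N0) -normrM !mulrBr ler_norml; apply/andP; split; lra.
Qed.

(** Classify the reals t by the residues of the floors of (N+1) (t c_i).  The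
    difference of two reals of the same class is an almost period.  There are
    finitely many classes, so that each real tau differs by a bounded amount
    from an almost period: subtract a fixed representative of its class. *)
Lemma relatively_dense_almost_periods (R : realType) (m : nat)
    (c : 'I_m -> R) (e : R) :
  0 < e -> exists2 K : R, 0 < K & forall tau : R, exists2 u : R,
    `|u - tau| <= K & forall i, exists p : int, `|u * c i - p%:~R| <= e.
Proof.
move=> e0.
pose N := Num.truncn e^-1.
have Ne : N.+1%:R^-1 <= e.
  rewrite -[leRHS]invrK lef_pV2 ?posrE ?invr_gt0//.
  exact/ltW/truncnS_gt.
(* The absolute value and inord only serve to view a residue as an ordinal. *)
pose resid (t : R) i := (Num.floor (N.+1%:R * (t * c i)) %% N.+1)%Z.
pose f (t : R) : {ffun 'I_m -> 'I_N.+1} := [ffun i => inord `|resid t i|%N].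
have resid_ge0 t i : 0 <= resid t i by rewrite modz_ge0.
have f_resid t t' i : f t = f t' -> resid t i = resid t' i.
  move=> /ffunP/(_ i); rewrite !ffunE => /(congr1 val) /=.
  have resid_lt s : (`|resid s i| < N.+1)%N.
    by rewrite -ltz_nat gez0_abs// ltz_pmod.
  rewrite !inordK// => /(congr1 Posz).
  by rewrite !gez0_abs.
pose rep (F : {ffun 'I_m -> 'I_N.+1}) : R := xget 0 [set t | f t = F].
have repP t : f (rep (f t)) = f t.
  by apply: (@xgetPex _ 0 [set s | f s = f t]); exists t.
exists (1 + \sum_F `|rep F|).
  by rewrite ltr_pwDl// sumr_ge0.
move=> tau; exists (tau - rep (f tau)).
  rewrite addrAC subrr add0r normrN (bigD1 (f tau)) //= addrCA lerDl.
  by rewrite addr_ge0// sumr_ge0.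
move=> i.
have /floor_congr_near_int[p hp] := esym (f_resid _ _ i (repP tau)).
exists p; rewrite mulrBl; exact: le_trans hp Ne.
Qed.

Lemma rat_row_clear_denominators (R : realType) (n : nat) (v : 'rV[rat]_n) :
  exists2 D : R, D != 0 & integer_points R n (D *: map_mx ratr v).
Proof.
exists (\prod_(j < n) denq (v 0 j))%:~R.
  by rewrite intr_eq0; apply/prodf_neq0 => j _; rewrite denq_eq0.
apply/mxOverP => i j; rewrite !mxE (ord1 i).
rewrite (bigD1 j)//= rmorphM/= mulrAC [_%:~R * _]mulrC.
rewrite rpredM ?intr_int//.
by rewrite /ratr divfK ?intr_int// intr_eq0 denq_eq0.
Qed.

Lemma rational_subspace_integer_combination (R : realType) (n : nat)
    (H : {vspace 'rV[R]_n}) (v : 'rV[R]_n) :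
  rational_subspace H -> v \in H ->
  exists m (w : 'I_m -> 'rV[R]_n) (c : 'I_m -> R),
    (forall i, w i \in H /\ integer_points R n (w i)) /\
    v = \sum_i c i *: w i.
Proof.
move=> [s ->]; set X := [seq _ | _ <- _] => vH.
have XP (i : 'I_(size X)) : exists D : R,
    D != 0 /\ integer_points R n (D *: X`_i).
  have := mem_nth 0 (ltn_ord i); set r := X`_i => /mapP[q _ ->].
  by have [D] := @rat_row_clear_denominators R n q; exists D.
have [D DP] := choice XP.
exists (size X), (fun i => D i *: X`_i),
  (fun i => coord (in_tuple X) i v / D i); split.
  move=> i; split; last by have [] := DP i.
  by rewrite memvZ// memv_span// mem_nth.
rewrite {1}(@coord_span _ _ _ (in_tuple X) v)//.
apply: eq_bigr => i _; rewrite scalerA divfK//.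
by have [] := DP i.
Qed.

(** If v = \sum_i c_i w_i with integer vectors w_i in H and u c_i is close to
    the integer p_i, then u v is close to \sum_i p_i w_i. *)
Lemma relatively_dense_returns (R : realType) (n : nat)
    (H : {vspace 'rV[R]_n}) (v : 'rV[R]_n) (e : R) :
  rational_subspace H -> v \in H -> 0 < e ->
  exists2 K : R, 0 < K & forall tau : R, exists2 u : R, `|u - tau| <= K &
    exists2 z, z \in H /\ integer_points R n z & `|u *: v - z| <= e.
Proof.
move=> Hr vH e0.
have [m [w [c [wP ->]]]] := rational_subspace_integer_combination Hr vH.
pose S := 1 + \sum_i `|w i|.
have S0 : 0 < S by rewrite ltr_pwDl// sumr_ge0.
have [K K0 KP] := relatively_dense_almost_periods c (divr_gt0 e0 S0).
exists K => // tau; have [u uK /choice[p pP]] := KP tau.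
exists u => //; exists (\sum_i (p i)%:~R *: w i).
  split; first by apply: memv_suml => i _; rewrite memvZ//; have [] := wP i.
  apply/mxOverP => i j; rewrite summxE rpred_sum// => l _.
  rewrite mxE rpredM ?intr_int//.
  by have [_ /mxOverP] := wP l.
rewrite scaler_sumr -sumrB (le_trans (ler_norm_sum _ _ _))//.
apply: (@le_trans _ _ (\sum_i e / S * `|w i|)).
  apply: ler_sum => i _; rewrite scalerA -scalerBl normrZ.
  by rewrite ler_wpM2r.
rewrite -mulr_sumr mulrAC ler_pdivrMr// ler_pM2l// /S lerDr//.
Qed.

(** * Simplices spanned along a flag *)

(** The points tau + s a with s in [0, sigma] fill the interval of length
    sigma |a| centred at tau + (sigma / 2) a, whence a solution of P within K of
    that centre is reached. *)
Lemma choose_step (R : realType) (tau a K sigma : R) (P : R -> Prop) :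
  0 < sigma -> 0 < K -> 2 * K <= sigma * `|a| ->
  (forall t, exists2 u, `|u - t| <= K & P u) ->
  exists2 s, 0 <= s <= sigma & P (tau + s * a).
Proof.
move=> s0 K0 Ka hP.
have a0 : 0 < `|a|.
  by rewrite -(pmulr_rgt0 _ s0) (lt_le_trans _ Ka)// mulr_gt0.
have [u uK Pu] := hP (tau + sigma / 2 * a).
have an0 : a != 0 by rewrite -normr_gt0.
have ua : u = tau + (u - tau) / a * a by field.
exists ((u - tau) / a); last by rewrite -ua.
set s := (_ / _) in ua *.
suff : `|s - sigma / 2| <= sigma / 2 by rewrite ler_norml => /andP[? ?]; lra.
rewrite -(ler_pM2r a0) -normrM mulrBl.
rewrite (_ : s * a = u - tau); last by rewrite [X in X - tau]ua; ring.
rewrite (_ : _ - _ = u - (tau + sigma / 2 * a)); last by ring.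
by apply: le_trans uK _; lra.
Qed.

(** Induction on k, removing the top vector.  Its step s is chosen so that
    the coefficient of v_k in x + s d_k is a return time; the rest of
    x + s d_k lies in V k, and the induction hypothesis applies to it with the
    remaining steps.  It is essential that M does not depend on x, since that
    rest can be arbitrarily far from x.  The range sigma of the steps stays the
    same in the induction, so that it can be matched with the total number of
    vertices in the end. *)
Lemma flag_simplex_near_lattice (R : realType) (n : nat)
    (H : {vspace 'rV[R]_n}) (V : nat -> {vspace 'rV[R]_n})
    (v : nat -> 'rV[R]_n) (k : nat) (sigma e : R) :
  rational_subspace H -> 0 < sigma -> 0 < e -> V 0%N = 0%VS ->
  (forall t, (t < k)%N -> v t \in H /\ V t.+1 = (V t + <[v t]>)%VS) ->
  exists2 M : R, 0 < M & forall x d, x \in V k ->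
    (forall t, (t < k)%N -> d t \in V t.+1 /\
       forall l, l \in V t -> M <= `|d t - l|) ->
    exists2 lam : nat -> R, (forall t, 0 <= lam t <= sigma) &
    exists2 z, z \in H /\ integer_points R n z &
      `|x + \sum_(t < k) lam t *: d t - z| <= e.
Proof.
move=> Hr s0 + V0; elim: k e => [|k IH] e e0 hV.
  exists 1 => // x d; rewrite V0 memv0 => /eqP -> _.
  exists (fun=> 0); first by move=> t; rewrite lexx ltW.
  exists 0; first by split; rewrite ?mem0v//; apply: mxOver0; rewrite rpred0.
  by rewrite big_ord0 addr0 subr0 normr0 ltW.
have e2 : 0 < e / 2 by rewrite divr_gt0.
have [|M M0 MP] := IH _ e2; first by move=> t tk; apply: hV; rewrite ltnW.
have [vH Vk] := hV _ (ltnSn k).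
have [K K0 KP] := relatively_dense_returns Hr vH e2.
(* The summand 1 makes the bound strict, also when v k = 0. *)
pose M' := 2 * K / sigma * (`|v k| + 1).
have M'0 : 0 < M' by rewrite mulr_gt0 ?divr_gt0 ?mulr_gt0// ltr_wpDl.
exists (M + M'); first exact: addr_gt0.
move=> x d xV dP.
have [] := dP _ (ltnSn k).
rewrite Vk => /memv_addP[l lV [_ /vlineP[a ->] dE]] far.
move: xV; rewrite Vk => /memv_addP[l0 l0V [_ /vlineP[tau ->] xE]].
have Ka : 2 * K <= sigma * `|a|.
  rewrite leNgt; apply/negP => aK.
  have := far _ lV; rewrite dE addrAC subrr add0r normrZ leNgt => /negP; apply.
  apply: (@le_lt_trans _ _ (2 * K / sigma * `|v k|)).
    by rewrite ler_wpM2r// ler_pdivlMr// mulrC ltW.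
  rewrite ltr_wpDl// ?ltW//.
  by rewrite ltr_pM2l ?ltrDl ?divr_gt0 ?mulr_gt0.
have [s sP [z [zH zI] zE]] := choose_step tau s0 K0 Ka KP.
have [|t tk|lam lamP [z' [z'H z'I] z'E]] := MP (l0 + s *: l) d.
- by rewrite memvD ?memvZ.
- have [dV dfar] := dP t (leqW tk); split=> // l1 /dfar.
  by apply: le_trans; rewrite lerDl ltW.
exists (fun t => if t == k then s else lam t).
  by move=> t; case: eqP.
exists (z' + z).
  split; first exact: memvD.
  apply/mxOverP => i j; rewrite mxE.
  by rewrite rpredD//; [move/mxOverP: z'I | move/mxOverP: zI].
rewrite big_ord_recr /= eqxx.
under eq_bigr => i _ do rewrite ltn_eqF//.
rewrite {1}xE dE (_ : _ - (z' + z) =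
  (l0 + s *: l + \sum_(i < k) lam i *: d i - z') +
  ((tau + s * a) *: v k - z)); last first.
  by set S := \sum_(i < k) _; apply/rowP => j; rewrite !mxE; ring.
apply: le_trans (ler_normD _ _) _.
by rewrite [leRHS]splitr lerD.
Qed.

(** * Small steps stay in the convex hull *)

Lemma convex_average (R : realType) (n : nat) (C : set 'rV[R]_n)
    (x : 'rV[R]_n) (q : nat -> 'rV[R]_n) (k : nat) :
  @convex_set R 'rV[R]_n C -> C x -> (forall t, (t < k)%N -> C (q t)) ->
  C (k.+1%:R^-1 *: (x + \sum_(t < k) q t)).
Proof.
move=> Cc Cx; elim: k => [|k IH] Cq.
  by rewrite big_ord0 addr0 invr1 scale1r.
have {}IH := IH (fun t tk => Cq t (leqW tk)).
have h0 : 0 <= (k.+2%:R^-1 : R) by rewrite invr_ge0.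
have h1 : (k.+2%:R^-1 : R) <= 1 by rewrite invf_le1// ler1n.
pose lam : {i01 R} := Itv01 h0 h1.
have /set_mem := Cc _ _ lam (mem_set (Cq k (ltnSn k))) (mem_set IH).
congr C.
rewrite /conv/= /convex_lmodType /=.
rewrite big_ord_recr /= addrA [in RHS]scalerDr [RHS]addrC; congr (_ + _).
rewrite scalerA; congr (_ *: _).
have k1 : k.+1%:R != 0 :> R by [].
have k2 : k.+2%:R != 0 :> R by [].
apply: (mulIf k1); rewrite divfK//; apply: (mulIf k2).
by rewrite mulrBl mul1r !mulVf// mulrAC mulVf// mul1r -natr1 addrK.
Qed.

(** The point is the average of x and of the k points x + (k+1) lam_t (y_t - x),
    each of which lies on the segment from x to y_t; the bound on lam_t is the
    one for which this holds. *)
Lemma conv_hull_small_steps (R : realType) (n k : nat) (A : set 'rV[R]_n)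
    (x : 'rV[R]_n) (y : nat -> 'rV[R]_n) (lam : nat -> R) :
  A x -> (forall t, (t < k)%N -> A (y t)) ->
  (forall t, 0 <= lam t <= k.+1%:R^-1) ->
  conv_hull A (x + \sum_(t < k) lam t *: (y t - x)).
Proof.
move=> Ax Ay lamP C [Cc AC].
have -> : x + \sum_(t < k) lam t *: (y t - x) = k.+1%:R^-1 *:
   (x + \sum_(t < k) (x + (k.+1%:R * lam t) *: (y t - x))).
  rewrite big_split /= sumr_const card_ord addrA -mulrS scalerDr.
  rewrite -[x *+ _]scaler_nat scalerA mulVf// scale1r; congr (_ + _).
  rewrite scaler_sumr; apply: eq_bigr => t _.
  by rewrite scalerA mulrA mulVf// mul1r.
pose q t := x + (k.+1%:R * lam t) *: (y t - x).
apply: (@convex_average _ _ _ _ q) => //.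
  exact: AC.
move=> t tk; have /andP[l0 l1] := lamP t.
have h0 : 0 <= k.+1%:R * lam t by rewrite mulr_ge0.
have h1 : k.+1%:R * lam t <= 1 by rewrite mulrC -ler_pdivlMr// div1r.
have /set_mem :=
  Cc _ _ (Itv01 h0 h1) (mem_set (AC _ (Ay _ tk))) (mem_set (AC _ Ax)).
congr C; rewrite /conv/= /convex_lmodType/= /unstable.onem.
by rewrite /q scalerBl scale1r scalerBr addrCA.
Qed.

(** * Distances and flags *)

Lemma enorm_le_norm (R : realType) (n : nat) (v : 'rV[R]_n) :
  enorm v <= n%:R * `|v|.
Proof.
rewrite -[leRHS]ger0_norm ?mulr_ge0// -sqrtr_sqr ler_wsqrtr//.
apply: (@le_trans _ _ (\sum_(j < n) `|v| ^+ 2)).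
  apply: ler_sum => j _; rewrite -real_normK ?num_real// lerXn2r ?nnegrE//.
  rewrite [leRHS]mx_normrE.
  exact: (le_bigmax _ (fun ij => `|v ij.1 ij.2|) (0, j)).
rewrite sumr_const card_ord exprMn -[leLHS]mulr_natl ler_wpM2r ?sqr_ge0//.
by rewrite -natrX ler_nat; case: (n) => // p; rewrite leq_pmulr.
Qed.

Lemma dist_le (R : realType) (n : nat) (A B : set 'rV[R]_n) a b :
  A a -> B b -> dist A B <= enorm (a - b).
Proof.
move=> Aa Bb; apply: ge_inf; last by exists a => //; exists b.
by exists 0 => _ [? _ [? _ <-]]; exact: sqrtr_ge0.
Qed.

Lemma vspace_add_line (K : fieldType) (W : vectType K) (U V : {vspace W}) :
  (U <= V)%VS -> \dim V = (\dim U).+1 ->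
  exists2 v, v \in V & V = (U + <[v]>)%VS.
Proof.
move=> UV dV.
have /subvPn[v vV vU] : ~~ (V <= U)%VS.
  by apply/negP => /dimvS; rewrite dV ltnn.
exists v => //; apply/esym/eqP; rewrite eqEdim subv_add UV -memvE vV /=.
rewrite dV ltn_neqAle dimvS ?addvSl// andbT.
apply: contra vU => /eqP dU.
have /eqP -> : U == (U + <[v]>)%VS by rewrite eqEdim addvSl dU leqnn.
by rewrite memvE addvSr.
Qed.

(* For t : 'I_k, the vector y_(t+1) is [y t], the subspace L_t is
   [L (widen_ord (leqnSn k) t)] and L_(t+1) is [L (lift ord0 t)]. *)
Theorem lemma8 (R : realType) (n k : nat)
    (L : 'I_k.+1 -> {vspace 'rV[R]_n}) (H : {vspace 'rV[R]_n})
    (L_chain : forall t : 'I_k,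
       (L (widen_ord (leqnSn k) t) <= L (lift ord0 t))%VS)
    (L_sub_H : (L ord_max <= H)%VS)
    (L_dim : forall t : 'I_k.+1, \dim (L t) = t)
    (H_rational : rational_subspace H)
    (delta : R) (delta_gt0 : 0 < delta) :
  exists M : R, 0 < M /\
    forall (x : 'rV[R]_n) (y : 'I_k -> 'rV[R]_n),
      x \in L ord_max ->
      (forall t : 'I_k,
         translate x (L (lift ord0 t)) (y t) /\
         M <= dist [set y t] (translate x (L (widen_ord (leqnSn k) t)))) ->
      dist (conv_hull (x |` range y))
           ([set` H] `&` integer_points R n) <= delta.
Proof.
(* The induction on the length of the flag is run on families over nat. *)
pose V t := L (inord t).
have VW (t : 'I_k) : V t = L (widen_ord (leqnSn k) t).
  by congr L; apply/val_inj; rewrite /= inordK// ltnS ltnW.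
have VS (t : 'I_k) : V t.+1 = L (lift ord0 t).
  by congr L; apply/val_inj; rewrite /= inordK// ltnS.
have Vk : V k = L ord_max by congr L; apply/val_inj; rewrite /= inordK.
have VH t : (t <= k)%N -> (V t <= H)%VS.
  move=> tk; rewrite -(subKn tk); elim: (k - t)%N => [|d IH].
    by rewrite subn0 Vk.
  rewrite subnS; case E: (k - d)%N IH => [|j] // IH.
  have jk : (j < k)%N by rewrite -E leq_subr.
  apply: subv_trans IH.
  by rewrite (VW (Ordinal jk)) (VS (Ordinal jk)).
have /choice[v vP] (t : nat) : exists v : 'rV[R]_n,
    (t < k)%N -> v \in H /\ V t.+1 = (V t + <[v]>)%VS.
  case: (ltnP t k) => [tk|]; last by exists 0.
  have [|v vV VE] := vspace_add_line (L_chain (Ordinal tk)).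
    by rewrite !L_dim.
  exists v => _; rewrite (VS (Ordinal tk)) (VW (Ordinal tk)) VE; split=> //.
  by apply: (subvP (VH _ tk)); rewrite (VS (Ordinal tk)).
have V0 : V 0%N = 0%VS.
  by apply/eqP; rewrite -dimv_eq0 L_dim inordK.
(* The summand 1 keeps N positive when n = 0. *)
pose N : R := 1 + n%:R.
have N0 : 0 < N by rewrite ltr_pwDl.
have enormN (u : 'rV[R]_n) : enorm u <= N * `|u|.
  by rewrite (le_trans (enorm_le_norm u))// ler_wpM2r// /N lerDr.
have s0 : 0 < k.+1%:R^-1 :> R by [].
have [M M0 MP] :=
  flag_simplex_near_lattice H_rational s0 (divr_gt0 delta_gt0 N0) V0 vP.
exists (N * M); split=> [|x y xL yP]; first exact: mulr_gt0.
pose y' t := if insub t is Some i then y i else x.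
have y'E (t : 'I_k) : y' t = y t by rewrite /y' valK.
have [||lam lamP [z [zH zI] zE]] := MP x (fun t => y' t - x).
- by rewrite Vk.
- move=> t tk; rewrite -[t]/(nat_of_ord (Ordinal tk)) y'E VS VW.
  have [[u uL <-] far] := yP (Ordinal tk); split.
    by rewrite addrAC subrr add0r.
  move=> l lL; rewrite -(ler_pM2l N0) (le_trans far)// -addrA -opprD.
  apply: le_trans (enormN _); apply: dist_le => //.
  by exists l.
apply: (@le_trans _ _ (enorm (x + \sum_(t < k) lam t *: (y' t - x) - z))).
  apply: dist_le => //; apply: conv_hull_small_steps => //; first by left.
  move=> t tk; right; exists (Ordinal tk) => //.
  by rewrite -[t]/(nat_of_ord (Ordinal tk)) y'E.
by rewrite (le_trans (enormN _))// mulrC -ler_pdivlMr.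
Qed.
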